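(* Let $\beta>0$, let $\{V_k\}_{k\ge1}$ be i.i.d. random variables such that $|V_k|\le\beta$ a.s., let $S_n=\sum_{k=1}^nV_k$ (with $S_0=0$), and extend $n\mapsto S_n$ to all positive real values $t\mapsto S_t$ by linear interpolation between $S_n$ and $S_{n+1}$. If $S_t$ and a standard Brownian motion $B_t$ are constructed on the same probability space (but not necessarily independent), then, almost surely, $$\limsup_{t\to\infty}\frac{|S_t-B_t|}{\log t}\ge\frac1{4\beta}.$$
   Context: Standard Brownian motion means $B_0=0$ and $\mathbb{E}B_t^2=t$ (i.e. $\sigma^2=1$). *)

(* Defs.v *)
From HB Require Import structures.
From mathcomp Require Import all_boot all_order all_algebra.
From mathcomp Require Import all_classical all_reals all_analysis.

Set Implicit Arguments.
Unset Strict Implicit.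
Unset Printing Implicit Defensive.

Import Order.TTheory GRing.Theory Num.Theory.
Import numFieldNormedType.Exports.

Local Open Scope classical_set_scope.
Local Open Scope ring_scope.

(* Product rule over every finite subfamily [s] of the index type. *)
Definition mutually_independent (d : measure_display) (T : measurableType d)
    (R : realType) (P : probability T R) (I : eqType) (X : I -> T -> R) : Prop :=
  forall (s : seq I) (A : I -> set R), uniq s -> (forall i, measurable (A i)) ->
    P (\big[setI/setT]_(i <- s) (X i @^-1` A i)) =
    (\prod_(i <- s) P (X i @^-1` A i))%E.

(* The laws are compared on measurable sets only: [distribution P X A] carries
   no meaning when [A] is not measurable. *)
Definition identically_distributed (d : measure_display) (T : measurableType d)
    (R : realType) (P : probability T R) (I : Type) (X : I -> {RV P >-> R}) :
    Prop :=
  forall (i j : I) (A : set R), measurable A ->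
    distribution P (X i) A = distribution P (X j) A.

Definition iid (d : measure_display) (T : measurableType d)
    (R : realType) (P : probability T R) (I : eqType) (X : I -> {RV P >-> R}) :
    Prop :=
  mutually_independent P (fun i => X i : T -> R) /\ identically_distributed X.

(* Only the values [B t] with [0 <= t] matter. The second parameter of
   [normal_prob] is the standard deviation, hence the square root. *)
Record standard_brownian_motion (d : measure_display) (T : measurableType d)
    (R : realType) (P : probability T R) (B : R -> {RV P >-> R}) : Prop := {
  bm_start : {ae P, forall w, B 0 w = 0};
  bm_continuous :
    {ae P, forall w, {within `[0, +oo[, continuous (fun t : R => B t w)}};
  bm_independent_increments : forall (n : nat) (t : nat -> R),
    0 <= t 0%N -> (forall i, (i < n)%N -> t i <= t i.+1) ->
    mutually_independent P
      (fun (i : 'I_n) (w : T) => B (t i.+1) w - B (t i) w);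
  bm_gaussian_increments : forall (s t : R) (A : set R),
    0 <= s -> s < t -> measurable A ->
    P ((fun w => B t w - B s w) @^-1` A) = normal_prob 0 (Num.sqrt (t - s)) A
}.

(* [V k] stands for the summand of index [k + 1], so that
   [partial_sum V n = V_1 + ... + V_n]. *)
Definition partial_sum (R : realType) (T : Type) (V : nat -> T -> R)
    (n : nat) (w : T) : R :=
  \sum_(k < n) V k w.

(* For [0 <= t]; [Num.truncn t] is then the integer part of [t]. *)
Definition linear_interpolation (R : realType) (u : nat -> R) (t : R) : R :=
  let n := Num.truncn t in u n + (t - n%:R) * (u n.+1 - u n).

(* Main.v *)
(** Over an interval of length [L], the walk moves by at most [beta L], whereas
    the Brownian motion climbs by at least [a L] with probability about
    [exp (- a ^ 2 L / 2)].  With [L = c ln t] and [a ^ 2 c / 2 < 1], these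
    probabilities have a divergent sum along consecutive disjoint intervals, so
    such climbs almost surely occur infinitely often, and each one forces
    [`|S - B|] to be at least [(a - beta) L / 2] at one end of the interval.
    Letting [c] tend to [2 / a ^ 2] gives the bound [(a - beta) / a ^ 2], which
    is largest at [a = 2 beta]. *)
Require Import Defs.
From HB Require Import structures.
From mathcomp Require Import all_boot all_order all_algebra.
From mathcomp Require Import all_classical all_reals all_analysis.
From mathcomp Require Import measurable_realfun ring lra.

Import Order.TTheory GRing.Theory Num.Theory.
Import numFieldNormedType.Exports.

Local Open Scope classical_set_scope.
Local Open Scope ring_scope.

(** * Lipschitz bound for the interpolated walk *)

Lemma ler_norm_sum_increments {R : realType} {u : nat -> R} {b : R} :
  (forall n, `|u n.+1 - u n| <= b) ->
  forall n k, `|u (n + k)%N - u n| <= b * k%:R.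
Proof.
move=> ub n; elim=> [|k IH]; first by rewrite addn0 subrr normr0 mulr0.
rewrite addnS -natr1 mulrDr mulr1.
have -> : u (n + k).+1 - u n = (u (n + k)%N - u n) + (u (n + k).+1 - u (n + k)%N).
  by ring.
by rewrite (le_trans (ler_normD _ _))// lerD.
Qed.

(** Within one unit cell the path is affine. Otherwise it is cut at the integers [n.+1] and [m],
    which leaves two partial cells and a stretch of the discrete walk. *)
Lemma linear_interpolation_lipschitz {R : realType} {u : nat -> R} {b : R} :
  (forall n, `|u n.+1 - u n| <= b) ->
  forall s t, 0 <= s -> s <= t ->
  `|linear_interpolation u t - linear_interpolation u s| <= b * (t - s).
Proof.
move=> ub s t s0 st; rewrite /linear_interpolation.
have t0 : 0 <= t by exact: le_trans st.
have /andP[ns sn] := truncn_itv s0; have /andP[mt tm] := truncn_itv t0.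
have := le_truncn st; move: (Num.truncn s) (Num.truncn t) ns sn mt tm => n m.
move=> ns sn mt tm; rewrite leq_eqVlt => /orP[/eqP nm|nm].
  rewrite -nm in mt tm *.
  have -> : u n + (t - n%:R) * (u n.+1 - u n) -
      (u n + (s - n%:R) * (u n.+1 - u n)) = (u n.+1 - u n) * (t - s) by ring.
  by rewrite normrM (ger0_norm (_ : 0 <= t - s)) ?subr_ge0// ler_wpM2r ?subr_ge0.
have := ler_norm_sum_increments ub n.+1 (m - n.+1); rewrite subnKC// natrB//.
move=> h.
have -> : u m + (t - m%:R) * (u m.+1 - u m) - (u n + (s - n%:R) * (u n.+1 - u n))
   = (t - m%:R) * (u m.+1 - u m) + (u m - u n.+1) + (n.+1%:R - s) * (u n.+1 - u n).
  by rewrite -(natr1 n); ring.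
have -> : b * (t - s) =
  (t - m%:R) * b + b * (m%:R - n.+1%:R) + (n.+1%:R - s) * b by ring.
rewrite (le_trans (ler_normD _ _))// lerD//.
  rewrite (le_trans (ler_normD _ _))// lerD//.
  by rewrite normrM (ger0_norm (_ : 0 <= t - m%:R)) ?subr_ge0// ler_wpM2l ?subr_ge0.
have ns0 : 0 <= n.+1%:R - s by rewrite subr_ge0 ltW.
by rewrite normrM (ger0_norm ns0) ler_wpM2l.
Qed.

(** * Lower bounds for Gaussian tails *)

(** The mass of the unit interval [[x, x + 1]] is already enough: there the density is at least its
    value at [x + 1]. *)
Lemma normal_prob_ge {R : realType} {v x : R} : 0 < v -> 0 <= x ->
  (((Num.sqrt (v * pi *+ 2))^-1 * expR (- ((x + 1) ^+ 2 / (v *+ 2))))%:E <=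
   normal_prob 0 (Num.sqrt v) `[x, +oo[%classic)%E.
Proof.
move=> v0 x0; rewrite /normal_prob.
set q := (X in X%:E).
have sv0 : Num.sqrt v != 0 by rewrite sqrtr_eq0 -ltNge.
have mpdf (D : set R) :
    measurable_fun D (EFin \o normal_pdf 0 (Num.sqrt v)).
  by apply/measurable_EFinP/measurable_funTS; exact: measurable_normal_pdf.
have sub : `[x, x + 1] `<=` `[x, +oo[%classic.
  by move=> y /=; rewrite !in_itv/= andbT => /andP[].
apply: (@le_trans _ _ (\int[lebesgue_measure]_(y in `[x, (x + 1)%R]%classic)
   (normal_pdf 0 (Num.sqrt v) y)%:E)%E); last first.
  apply: ge0_subset_integral => //.
    exact: mpdf.
  by move=> y _; rewrite lee_fin normal_pdf_ge0.
apply: (@le_trans _ _ (\int[lebesgue_measure]_(y in `[x, (x + 1)%R]%classic)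
   (cst q%:E) y)%E).
  rewrite integral_cst//= lebesgue_measure_itv/= lte_fin ltrDl ltr01.
  by rewrite -EFinB addrAC subrr add0r mule1.
apply: ge0_le_integral => //.
- by move=> y _; rewrite lee_fin mulr_ge0// ?expR_ge0// invr_ge0 sqrtr_ge0.
- exact: mpdf.
move=> y /=; rewrite in_itv/= => /andP[xy yx].
rewrite lee_fin normal_pdfE// /normal_peak /normal_fun.
rewrite (sqr_sqrtr (ltW v0)) /q ler_wpM2l ?invr_ge0 ?sqrtr_ge0// ler_expR subr0 mulNr lerN2.
rewrite ler_wpM2r// ?invr_ge0 ?mulrn_wge0 ?(ltW v0)//.
rewrite ler_sqr ?nnegrE//; [exact: le_trans xy| by rewrite addr_ge0].
Qed.

Lemma near_ln_le {R : realType} {c e} (K : R) : 0 < c -> 0 < e ->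
  \forall x \near +oo, ln (c * x) + K <= e * x.
Proof.
move=> c0 e0; have e20 : 0 < e / 2 by rewrite divr_gt0.
near=> x.
have x0 : 0 < x by near: x; exact: nbhs_pinfty_gt.
(* One half of [e * x] dominates the logarithm of itself, the other half absorbs the constants. *)
have -> : c * x = (c / (e / 2)) * (e / 2 * x) by field; lra.
rewrite lnM ?posrE ?mulr_gt0 ?invr_gt0//.
have := ln_sublinear (mulr_gt0 e20 x0).
have : (e / 2)^-1 * (ln (c / (e / 2)) + K) < x.
  by near: x; apply: nbhs_pinfty_gt; rewrite num_real.
rewrite mulrC ltr_pdivrMr// => h1 h2.
have -> : e * x = e / 2 * x + x * (e / 2) by field.
lra.
Unshelve. all: by end_near. Qed.

(** The exponent is [a ^+ 2 * c / 2 * x] up to a bounded term, so its slack below [x] grows linearly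
    and absorbs the logarithm of the prefactor. *)
Lemma near_normal_prob_ge {R : realType} {a c : R} : 0 < a -> 0 < c ->
  a ^+ 2 * c / 2 < 1 ->
  \forall x \near +oo,
  ((expR (- x))%:E <=
   normal_prob 0 (Num.sqrt (c * x)) `[(a * (c * x))%R, +oo[%classic)%E.
Proof.
move=> a0 c0 ac1.
have pic0 : 0 < pi * 2 * c :> R by rewrite !mulr_gt0// pi_gt0.
have d0 : 0 < 2 * (1 - a ^+ 2 * c / 2) by rewrite mulr_gt0// subr_gt0.
near=> x.
have x1 : 1 <= x by near: x; apply: nbhs_pinfty_ge.
have x0 : 0 < x by exact: lt_le_trans x1.
have cx0 : 0 < c * x by rewrite mulr_gt0.
apply: le_trans (normal_prob_ge cx0 _); last by rewrite !mulr_ge0 ?ltW.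
rewrite lee_fin.
have y0 : 0 < c * x * pi *+ 2 by rewrite mulrn_wgt0// mulr_gt0// pi_gt0.
have -> : (Num.sqrt (c * x * pi *+ 2))^-1 = expR (- (ln (c * x * pi *+ 2) / 2)).
  rewrite expRN; congr (_^-1).
  apply/eqP; rewrite -(@eqrXn2 _ 2)// ?sqrtr_ge0 ?expR_ge0//.
  by rewrite (sqr_sqrtr (ltW y0)) -expRM_natr divfK// lnK.
rewrite -expRD ler_expR.
(* This is the required comparison of exponents, doubled; the term [c^-1] comes from bounding [x^-1]
   by 1. *)
have : ln (pi * 2 * c * x) + (2 * a + c^-1) <= 2 * (1 - a ^+ 2 * c / 2) * x.
  by near: x; exact: near_ln_le.
have -> : pi * 2 * c * x = c * x * pi *+ 2 by rewrite mulr2n; ring.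
have -> : (a * (c * x) + 1) ^+ 2 / (c * x *+ 2) =
   a ^+ 2 * c / 2 * x + a + c^-1 / 2 * x^-1.
  by rewrite mulr2n; field; rewrite !gt_eqF// addr_gt0.
have : c^-1 / 2 * x^-1 <= c^-1 / 2.
  by rewrite ler_piMr ?invf_le1// divr_ge0// invr_ge0 ltW.
lra.
Unshelve. all: by end_near. Qed.

(** * Limit superior, divergent series and the second Borel-Cantelli lemma *)

Lemma ge_limf_esup {R : realType} (f : R -> R) (r : R) :
  (forall M, exists2 t, M < t & r <= f t) ->
  (r%:E <= limf_esup (fun t => (f t)%:E) (+oo%R : set_system R))%E.
Proof.
move=> h; rewrite limf_esupE; apply: le_ereal_inf_tmp => _ /= [A [M [_ MA]] <-].
have [t Mt rt] := h M.
apply: (@le_trans _ _ (f t)%:E); first by rewrite lee_fin.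
by apply: ereal_sup_ubound; exists t => //; exact: MA.
Qed.

Lemma le_prod1B_expR {R : realType} (N : nat) (p : nat -> R) :
  (forall i, p i <= 1) -> \prod_(i < N) (1 - p i) <= expR (- \sum_(i < N) p i).
Proof.
move=> p1; rewrite -sumrN expR_sum.
by apply: ler_prod => i _; rewrite subr_ge0 p1/= expR_ge1Dx.
Qed.

(** Otherwise the series without its first [n] terms would be monotone and bounded, hence
    convergent. *)
Lemma dvg_series_tail {R : realType} {u : nat -> R} :
  (forall k, 0 <= u k) -> ~ cvgn (series u) ->
  forall n M, exists N, M < \sum_(i < N) u (n + i)%N.
Proof.
move=> u0 du n M; apply: contrapT => /forallNP h; apply: du.
rewrite -(is_cvg_series_restrict n).
apply: nondecreasing_is_cvgn.
  apply/nondecreasing_seqP => k; have [nk|kn] := leqP n k.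
    by rewrite /= big_nat_recr//= lerDl.
  by rewrite /= !big_geq// ltnW.
exists M => _ [N _ <-]/=.
rewrite -{1}[n]add0n big_addn big_mkord leNgt; apply/negP => MN.
by apply: (h (N - n)%N); under eq_bigr do rewrite addnC.
Qed.

Lemma dvg_series_ge_harmonic {R : realType} {u : nat -> R} :
  (forall k, 0 <= u k) -> (\forall k \near \oo, k.+2%:R^-1 <= u k) ->
  ~ cvgn (series u).
Proof.
move=> u0 [k0 _ hu] cu.
(* The tail starts at [k0.+1] because [harmonic] at [k.+1] is the inverse of [k.+2]. *)
have [k|N] := dvg_series_tail _ (@dvg_harmonic R) k0.+1 (limn (series u)).
  by rewrite invr_ge0 ler0n.
apply/negP; rewrite -leNgt.
apply: (@le_trans _ _ (series u (k0 + N)%N)); last first.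
  apply: nondecreasing_cvgn_le => //; apply/nondecreasing_seqP => k.
  by rewrite seriesSr lerDl.
rewrite /series/= (@big_cat_nat _ _ _ k0) ?leq_addr//=.
rewrite -[leLHS]add0r lerD ?sumr_ge0//.
have -> : \sum_(k0 <= i < k0 + N) u i = \sum_(i < N) u (i + k0)%N.
  by rewrite -{1}[k0]add0n big_addn addKn big_mkord.
rewrite ler_sum// => i _; by rewrite /harmonic addSn [(i + k0)%N]addnC; apply: hu; rewrite /= leq_addr.
Qed.

(** By [1 - p <= expR (- p)], a block of events all fail with probability at most the exponential of
    minus a partial sum. Independence enters only through the complements over consecutive
    indices. *)
Lemma borel_cantelli2 {d : measure_display} {T : measurableType d} {R : realType}
    (P : probability T R) (A : nat -> set T) :
  (forall k, measurable (A k)) ->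
  (forall n N, P (\big[setI/setT]_(i < N) ~` A (n + i)%N) =
     (\prod_(i < N) P (~` A (n + i)%N))%E) ->
  ~ cvgn (series (fun k => fine (P (A k)))) ->
  {ae P, forall w, forall n, exists2 k, (n <= k)%N & A k w}.
Proof.
move=> mA indepA dA; apply: ae_foralln => n.
have mI N : measurable (\big[setI/setT]_(i < N) ~` A (n + i)%N).
  by apply: bigsetI_measurable => i _; exact: measurableC.
have PI N : (P (\big[setI/setT]_(i < N) ~` A (n + i)%N) <=
    (expR (- \sum_(i < N) fine (P (A (n + i)%N))))%:E)%E.
  rewrite indepA (eq_bigr (fun i : 'I_N => (1 - fine (P (A (n + i)%N)))%:E)).
    rewrite prodEFin lee_fin; apply: (le_prod1B_expR N (fun i => fine (P (A (n + i)%N)))) => i.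
    by rewrite -lee_fin fineK ?fin_num_measure// probability_le1.
  by move=> i _; rewrite probability_setC// EFinB fineK ?fin_num_measure.
exists (\bigcap_i ~` A (n + i)%N); split.
- by apply: bigcapT_measurable => i; exact: measurableC.
- apply/eqP; rewrite -measure_le0; apply/lee_addgt0Pr => e e0; rewrite add0e.
  (* A partial sum above [- ln e] brings the exponential bound below [e]. *)
  have [k|N] := dvg_series_tail _ dA n (- ln e).
    by rewrite fine_ge0.
  rewrite ltrNl => hN.
  apply: le_trans (_ : P (\big[setI/setT]_(i < N) ~` A (n + i)%N) <= _)%E.
    apply: le_measure; rewrite ?inE//.
      by apply: bigcapT_measurable => i; exact: measurableC.
    by rewrite -(bigcap_mkord _ (fun i => ~` A (n + i)%N)) => w h i _; exact: h.
  apply: le_trans (PI N) _; rewrite lee_fin -[leRHS](@lnK _ e)// ler_expR.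
  exact: ltW.
- move=> w /= h i _ Ai; apply: h; exists (n + i)%N => //; exact: leq_addr.
Qed.

Lemma brownian_increments_io {d : measure_display} {T : measurableType d}
    {R : realType} {P : probability T R} {B : R -> {RV P >-> R}}
    (t : nat -> R) (D : nat -> set R) :
  standard_brownian_motion B -> 0 <= t 0%N ->
  (forall k, t k <= t k.+1) -> (forall k, measurable (D k)) ->
  ~ cvgn (series (fun k => fine (P ((fun w => B (t k.+1) w - B (t k) w) @^-1` D k)))) ->
  {ae P, forall w, forall n, exists2 k, (n <= k)%N &
    D k (B (t k.+1) w - B (t k) w)}.
Proof.
move=> BM t0 tS mD; apply: borel_cantelli2.
  move=> k; rewrite -[X in measurable X]setTI.
  by apply: (measurable_funB _ _ measurableT).
move=> n N.
have tn0 : 0 <= t (n + 0)%N.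
  by elim: n => [//|n IH]; rewrite addn0; apply: le_trans (tS _); rewrite -(addn0 n).
(* Independence of increments is applied to the time grid shifted by [n], with the full index set as
   subfamily. *)
have /(_ (index_enum 'I_N) (fun i => ~` D (n + i)%N) (index_enum_uniq _)) :
    mutually_independent P
      (fun (i : 'I_N) w => B (t (n + i).+1) w - B (t (n + i)%N) w).
  have /= := @bm_independent_increments _ _ _ _ _ BM N (fun i => t (n + i)%N) tn0.
  have -> : (fun (i : 'I_N) w => B (t (n + i.+1)%N) w - B (t (n + i)%N) w) =
            (fun (i : 'I_N) w => B (t (n + i).+1) w - B (t (n + i)%N) w).
    by apply/funext => i; rewrite addnS.
  by apply => i _; rewrite addnS.
apply => i; exact: measurableC.
Qed.

(** * Logarithmic time steps and the climbs of Brownian motion *)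

Lemma near_ln_nat {R : realType} (Q : R -> Prop) :
  (\forall x \near +oo, Q x) -> \forall k \near \oo, Q (ln k.+2%:R).
Proof.
move=> [M [_ MQ]]; near=> k; apply: MQ.
rewrite -ltr_expR lnK ?posrE ?ltr0n//.
apply: (@lt_trans _ _ k%:R); last by rewrite ltr_nat.
by near: k; exact: nbhs_infty_gtr.
Unshelve. all: by end_near. Qed.

(** The difference [s - y] changes by at least [l] between the two ends, so it cannot be smaller
    than [l / 2] in absolute value at both. *)
Lemma discrepancy_ge_half {R : realFieldType} (s s' y y' l : R) :
  `|s' - s| <= l -> 2 * l <= y' - y ->
  l / 2 <= `|s - y| \/ l / 2 <= `|s' - y'|.
Proof.
rewrite ler_norml => /andP[_ hs] hy.
have [h1|h1] := leP (l / 2) `|s - y|; first by left.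
have [h2|h2] := leP (l / 2) `|s' - y'|; first by right.
move: h1 h2; rewrite !ltr_norml => /andP[h1 h2] /andP[h3 h4]; lra.
Qed.

(** Endpoints of the consecutive intervals; the shift [j.+2] makes every length positive when [c]
    is. *)
Definition log_time {R : realType} (c : R) (k : nat) : R := \sum_(j < k) c * ln j.+2%:R.

Lemma log_timeS {R : realType} (c : R) k :
  log_time c k.+1 - log_time c k = c * ln k.+2%:R.
Proof. by rewrite /log_time big_ord_recr/= addrAC subrr add0r. Qed.

Lemma log_time_nd {R : realType} (c : R) k :
  0 < c -> log_time c k <= log_time c k.+1.
Proof.
by move=> c0; rewrite -subr_ge0 log_timeS mulr_ge0 ?ln_ge0 ?ler1n ?ltW.
Qed.

Lemma near_log_time_gt {R : realType} (c M : R) :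
  0 < c -> \forall k \near \oo, M < log_time c k.
Proof.
move=> c0.
have ln2 : 0 < c * ln 2 :> R by rewrite mulr_gt0// ln_gt0// ltr1n.
near=> k; apply: (@lt_le_trans _ _ (\sum_(j < k) c * ln 2)).
  rewrite sumr_const card_ord -[X in _ < X]mulr_natl -ltr_pdivrMr//.
  by near: k; exact: nbhs_infty_gtr.
rewrite ler_sum// => j _; rewrite ler_wpM2l ?(ltW c0)// ler_ln ?posrE ?ltr0n//.
by rewrite ler_nat.
Unshelve. all: by end_near. Qed.

(** Since [log_time c k.+1] is at most [k.+2%:R * (c * ln k.+2%:R)], only an iterated logarithm has
    to be absorbed by [e]. This compares [ln t] with the interval length. *)
Lemma near_ln_log_time {R : realType} (c e : R) : 0 < c -> 0 < e ->
  \forall k \near \oo, ln (log_time c k.+1) <= (1 + e) * ln k.+2%:R.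
Proof.
move=> c0 e0; near=> k.
have lk : 0 < ln k.+2%:R :> R by rewrite ln_gt0// ltr1n.
have k2 : 0 < k.+2%:R :> R by rewrite ltr0n.
have tk : 0 < log_time c k.+1.
  by apply: (@lt_le_trans _ _ (log_time c k)); [near: k; exact: near_log_time_gt|
    exact: log_time_nd].
apply: (@le_trans _ _ (ln (k.+2%:R * (c * ln k.+2%:R)))).
  rewrite ler_ln ?posrE ?mulr_gt0//.
  apply: (@le_trans _ _ (\sum_(j < k.+1) c * ln k.+2%:R)).
    rewrite ler_sum// => j _; rewrite ler_wpM2l ?(ltW c0)//.
    by rewrite ler_ln ?posrE ?ltr0n// ler_nat ltnS ltn_ord.
  rewrite sumr_const card_ord -[leLHS]mulr_natl ler_wpM2r ?ler_nat//.
  by rewrite mulr_ge0 ?ltW.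
rewrite lnM ?posrE ?mulr_gt0// mulrDl mul1r lerD2l -[leLHS]addr0.
near: k; apply: (near_ln_nat (fun x => ln (c * x) + 0 <= e * x)).
exact: near_ln_le.
Unshelve. all: by end_near. Qed.

Lemma brownian_log_increments_io {d : measure_display} {T : measurableType d}
    {R : realType} {P : probability T R} {B : R -> {RV P >-> R}} {a c : R} :
  standard_brownian_motion B -> 0 < a -> 0 < c -> a ^+ 2 * c / 2 < 1 ->
  {ae P, forall w, forall n, exists2 k, (n <= k)%N &
    a * (c * ln k.+2%:R) <= B (log_time c k.+1) w - B (log_time c k) w}.
Proof.
move=> BM a0 c0 ac1.
have : {ae P, forall w, forall n, exists2 k, (n <= k)%N &
    `[a * (c * ln k.+2%:R), +oo[%classic
      (B (log_time c k.+1) w - B (log_time c k) w)}.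
  apply: (brownian_increments_io (log_time c)
    (fun k => `[a * (c * ln k.+2%:R), +oo[%classic)) => //.
  - by rewrite /log_time big_ord0.
  - by move=> k; exact: log_time_nd.
  apply: dvg_series_ge_harmonic => [k|]; first by rewrite fine_ge0.
  near=> k; rewrite (bm_gaussian_increments BM)//.
  + rewrite log_timeS -lee_fin.
    rewrite [leRHS]fineK ?fin_num_measure//.
    (* At [x = ln k.+2%:R] the Gaussian bound [expR (- x)] is exactly the harmonic term. *)
    rewrite -[k.+2%:R in leLHS](@lnK R) ?posrE ?ltr0n// -expRN.
    near: k; apply: (near_ln_nat (fun x => ((expR (- x))%:E <=
      normal_prob 0 (Num.sqrt (c * x)) `[(a * (c * x))%R, +oo[%classic)%E)).
    exact: near_normal_prob_ge.
  + by apply: sumr_ge0 => j _; rewrite mulr_ge0 ?ln_ge0 ?ler1n ?ltW.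
  + by rewrite -subr_gt0 log_timeS mulr_gt0// ln_gt0// ltr1n.
apply: filterS => w h n; have [k nk] := h n.
by rewrite /= in_itv/= andbT; exists k.
Unshelve. all: by end_near. Qed.

(** * The lower bound on the discrepancy *)

(** Taking [c] below its critical value costs a factor [1 - e], and bounding [ln t] costs [1 + e];
    their quotient is at least [1 - 2 * e]. *)
Lemma limf_esup_discrepancy_ge {d : measure_display} {T : measurableType d}
    {R : realType} {P : probability T R} {B : R -> {RV P >-> R}}
    {V : nat -> {RV P >-> R}} {beta e : R} :
  0 < beta -> 0 < e < 2^-1 -> (forall k, {ae P, forall w, `|V k w| <= beta}) ->
  standard_brownian_motion B ->
  {ae P, forall w,
    (((1 - 2 * e) / (4 * beta))%:E <=
     limf_esup
       (fun t : R =>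
          (`|linear_interpolation
               (fun n => partial_sum (fun k => V k : T -> R) n w) t
             - B t w| / ln t)%:E)
       (+oo%R : set_system R))%E}.
Proof.
move=> b0 /andP[e0 e2] Vb BM.
have bn0 : beta != 0 by rewrite gt_eqF.
(* The slope [2 beta] maximizes [(a - beta) / a ^ 2], and [c] makes
   [a ^ 2 c / 2 = 1 - e]. *)
pose c := (1 - e) / (2 * beta ^+ 2).
have c0 : 0 < c by rewrite divr_gt0 ?mulr_gt0 ?exprn_gt0//; lra.
have bc : (2 * beta) ^+ 2 * c / 2 < 1.
  have -> : (2 * beta) ^+ 2 * c / 2 = 1 - e by rewrite /c; field.
  by rewrite ltrBlDr ltrDl.
have b20 : 0 < 2 * beta by rewrite mulr_gt0.
have /ae_foralln := Vb.
apply: filterS2 (brownian_log_increments_io BM b20 c0 bc) => w io Vw.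
apply: ge_limf_esup => M.
have [n _ hn] : \forall k \near \oo, [/\ M < log_time c k, 1 < log_time c k &
    ln (log_time c k.+1) <= (1 + e) * ln k.+2%:R].
  near=> k; split; near: k; [exact: near_log_time_gt|exact: near_log_time_gt|].
  exact: near_ln_log_time.
have {io}[k /hn[Mk k1 lnk] hB] := io n.
have kS : log_time c k <= log_time c k.+1 by exact: log_time_nd.
set S := linear_interpolation _.
have hS : `|S (log_time c k.+1) - S (log_time c k)| <= beta * (c * ln k.+2%:R).
  rewrite -log_timeS; apply: linear_interpolation_lipschitz => //.
    by move=> m; rewrite /partial_sum big_ord_recr/= addrAC subrr add0r.
  by rewrite (le_trans _ (ltW k1)).
(* Stated for any [t] up to the right end, so that it serves whichever end carries the large
   discrepancy; [1 < t] makes [ln t] positive. *)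
have half_ge t : 1 < t -> t <= log_time c k.+1 ->
    beta * (c * ln k.+2%:R) / 2 <= `|S t - B t w| ->
    (1 - 2 * e) / (4 * beta) <= `|S t - B t w| / ln t.
  move=> t1 tk; rewrite ler_pdivlMr ?ln_gt0//; apply: le_trans.
  have lnt : ln t <= (1 + e) * ln k.+2%:R.
    by rewrite (le_trans _ lnk)// ler_ln ?posrE// (lt_trans ltr01)// (lt_le_trans t1).
  have e12 : 0 <= (1 - 2 * e) / (4 * beta).
    by rewrite divr_ge0 ?mulr_ge0 ?(ltW b0)//; lra.
  apply: le_trans (ler_wpM2l e12 lnt) _; rewrite mulrA.
  have -> : beta * (c * ln k.+2%:R) / 2 = (1 - e) / (4 * beta) * ln k.+2%:R.
    by rewrite /c; field.
  rewrite ler_wpM2r ?ln_ge0 ?ler1n// mulrAC.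
  (* The remaining inequality is [(1 - 2 * e) * (1 + e) <= 1 - e], with gap [2 * e ^+ 2]. *)
  by rewrite ler_wpM2r ?invr_ge0 ?mulr_ge0 ?(ltW b0)//; nra.
have := @discrepancy_ge_half _ _ _ (B (log_time c k) w) (B (log_time c k.+1) w) _ hS.
rewrite mulrA => /(_ hB)[h|h].
  by exists (log_time c k) => //; exact: half_ge.
exists (log_time c k.+1); first exact: lt_le_trans kS.
by apply: half_ge => //; exact: lt_le_trans kS.
Unshelve. all: by end_near. Qed.

Theorem theorem5p7 (R : realType) (d : measure_display) (T : measurableType d)
  (P : probability T R) (beta : R) (V : nat -> {RV P >-> R})
  (B : R -> {RV P >-> R})
  (beta_gt0 : 0 < beta)
  (V_iid : iid V)
  (V_bounded : forall k, {ae P, forall w, `|V k w| <= beta})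
  (B_brownian : standard_brownian_motion B) :
  {ae P, forall w,
    ((1 / (4 * beta))%:E <=
     limf_esup
       (fun t : R =>
          (`|linear_interpolation
               (fun n => partial_sum (fun k => V k : T -> R) n w) t
             - B t w| / ln t)%:E)
       (+oo%R : set_system R))%E}.
Proof.
(* A countable family of losses tending to 0, so that a single null set serves them all. *)
have e_itv (n : nat) : 0 < (n.+3%:R : R)^-1 < 2^-1.
  by rewrite invr_gt0 ltr0n/= ltf_pV2 ?posrE ?ltr0n// ltr_nat.
have := fun n => limf_esup_discrepancy_ge beta_gt0 (e_itv n) V_bounded B_brownian.
move=> /ae_foralln.
apply: filterS => w h; apply/lee_addgt0Pr => e e0.
near \oo => n.
(* With [n] this large, the loss [2 * n.+3%:R^-1 / (4 * beta)] is at most [e]. *)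
have hn : (2 * beta * e)^-1 < n%:R by near: n; exact: nbhs_infty_gtr.
apply: le_trans (leeD2r e%:E (h n)); rewrite -EFinD lee_fin.
have n3 : (2 * beta * e)^-1 <= n.+3%:R.
  by rewrite (le_trans (ltW hn))// ler_nat -addn3 leq_addr.
have be0 : 0 < 2 * beta * e by rewrite !mulr_gt0.
have ne : n.+3%:R^-1 <= 2 * beta * e.
  by rewrite -[leRHS]invrK lef_pV2 ?posrE ?invr_gt0.
rewrite mulrBl -addrA lerDl addrC subr_ge0 ler_pdivrMr ?mulr_gt0//.
have -> : e * (4 * beta) = 2 * (2 * beta * e) by ring.
by rewrite ler_wpM2l.
Unshelve. all: by end_near. Qed.
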